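(* Let $\mathcal{G}=(\mathcal{V},\mathcal{E})$ be a simple graph on $n$ nodes $\mathcal{V}=\{1,\dots,n\}$, with Laplacian matrix $L_{\mathcal{G}}$. Then, for a given radius $r$ (a nonnegative integer), the Laplacian spectral moments can be written as $$m_k(L_{\mathcal{G}})=\frac{1}{n}\sum_{i=1}^{n}\left[L_{i,r}^{k}\right]_{11}$$ for every positive integer $k\le 2r+1$, where $L_{i,r}$ is the local Laplacian submatrix of radius $r$ around node $i$, with its first row and column associated with node $i$.
   Context: A simple graph $\mathcal{G}=(\mathcal{V},\mathcal{E})$ is finite, undirected, unweighted and has no self-loops. Its Laplacian matrix is $L_{\mathcal{G}}=D_{\mathcal{G}}-A_{\mathcal{G}}$, where $A_{\mathcal{G}}$ is the adjacency matrix and $D_{\mathcal{G}}=\mathrm{diag}(d_i)$ is the diagonal matrix of node degrees. If $\lambda_1,\dots,\lambda_n$ are the eigenvalues of $L_{\mathcal{G}}$ (with multiplicity), the $k$-th Laplacian spectral moment is $m_k(L_{\mathcal{G}})=\frac{1}{n}\sum_{i=1}^n\lambda_i^k$. Let $\delta(i,j)$ be the graph distance in $\mathcal{G}$, i.e. the minimum length of a walk from $i$ to $j$, with $\delta(i,i)=0$. Let $\mathcal{N}_{i,r}=\{j\in\mathcal{V}:\delta(i,j)\le r\}$. For a set of nodes $\mathcal{K}\subseteq\mathcal{V}$, $L_{\mathcal{G}}(\mathcal{K})$ denotes the submatrix of $L_{\mathcal{G}}$ formed by the rows and columns indexed by $\mathcal{K}$ (so its diagonal entries are the degrees in the whole graph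 $\mathcal{G}$). The local Laplacian submatrix is $L_{i,r}=L_{\mathcal{G}}(\mathcal{N}_{i,r})$, with rows and columns ordered so that the first row and column correspond to node $i$. Thus $[L_{i,r}^k]_{11}$ is the diagonal entry of the $k$-th power of $L_{i,r}$ corresponding to node $i$. *)

(* Defs.v *)
From HB Require Import structures.
From mathcomp Require Import all_boot all_order all_algebra.
From mathcomp Require Import complex.
Set Implicit Arguments.
Unset Strict Implicit.
Unset Printing Implicit Defensive.
Import Order.TTheory GRing.Theory Num.Theory.
Local Open Scope ring_scope.

Record sgraph (n : nat) := SGraph {
  adj :> rel 'I_n;
  adj_sym : symmetric adj;
  adj_irrefl : irreflexive adj
}.

Section Laplacian.
Variables (R : nzRingType) (n : nat) (G : sgraph n).

Definition degree (i : 'I_n) : nat := #|[set j | G i j]|.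

Definition adjacency_mx : 'M[R]_n := \matrix_(i, j) (G i j)%:R.

Definition degree_mx : 'M[R]_n := diag_mx (\row_i (degree i)%:R).

Definition laplacian : 'M[R]_n := degree_mx - adjacency_mx.

Lemma laplacian_sym : laplacian^T = laplacian.
Proof.
rewrite /laplacian linearB /= /degree_mx tr_diag_mx; congr (_ - _).
by apply/matrixP => i j; rewrite !mxE adj_sym.
Qed.

End Laplacian.

Section Spectrum.
Variables (R : rcfType) (n : nat) (A : 'M[R]_n).

Lemma complex_conj_fix (a : R[i]) : a^* = a -> a = (complex.Re a)%:C%C.
Proof.
case: a => x y [] /eqP; rewrite eq_sym -subr_eq0 opprK -mulr2n mulrn_eq0 /=.
by move/eqP ->.
Qed.

Lemma sym_eigenvalue_real (hA : A^T = A) (a : R[i]) :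
  eigenvalue (map_mx (real_complex R) A) a -> a = (complex.Re a)%:C%C.
Proof.
case/eigenvalueP => v /matrixP hv v_neq0.
pose q := \sum_j (\sum_i v ord0 i * (A i j)%:C%C) * (v ord0 j)^*.
pose N := \sum_j v ord0 j * (v ord0 j)^*.
have qN : q = a * N.
  rewrite /q /N mulr_sumr; apply: eq_bigr => j _; rewrite mulrA; congr (_ * _).
  have := hv ord0 j; rewrite !mxE => <-.
  by apply: eq_bigr => i _; rewrite mxE.
have N_neq0 : N != 0.
  apply: contra_neq v_neq0 => N0; apply/rowP => j; rewrite mxE.
  have : v ord0 j * (v ord0 j)^* = 0.
    by apply: (psumr_eq0P _ N0) => // k _; rewrite mul_conjC_ge0.
  by move/eqP; rewrite mul_conjC_eq0 => /eqP.
have conjA (x : R) : (x%:C%C : R[i])^* = x%:C%C.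
  by apply/eqP; rewrite eq_complex /= oppr0 !eqxx.
have Nc : N^* = N.
  rewrite /N rmorph_sum; apply: eq_bigr => j _.
  by rewrite rmorphM /= conjCK mulrC.
have qc : q^* = q.
  rewrite /q rmorph_sum /=.
  under eq_bigr do rewrite rmorphM /= conjCK rmorph_sum /= mulr_suml.
  under [RHS]eq_bigr do rewrite mulr_suml.
  rewrite exchange_big /=; apply: eq_bigr => i _; apply: eq_bigr => j _.
  rewrite rmorphM /= conjA -[in LHS]hA mxE.
  by rewrite mulrC [X in _ * X = _]mulrC mulrA.
apply: complex_conj_fix; apply: (mulIf N_neq0).
by rewrite -qN -{1}Nc -rmorphM -qN.
Qed.

Lemma sym_char_poly_split (hA : A^T = A) :
  exists s : n.-tuple R, char_poly A == \prod_(x <- s) ('X - x%:P).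
Proof.
pose f := real_complex R.
have [s hs] := closed_field_poly_normal (char_poly (map_mx f A)).
move: hs; rewrite (monicP (char_poly_monic _)) scale1r => hs.
have hr : {in s, forall a, f (complex.Re a) = a}.
  move=> a sa; apply/esym/(sym_eigenvalue_real hA).
  by rewrite eigenvalue_root_char hs root_prod_XsubC.
have hp : char_poly A = \prod_(x <- map (@complex.Re R) s) ('X - x%:P).
  apply: (@map_poly_inj _ _ f); rewrite map_char_poly hs rmorph_prod big_map /=.
  rewrite big_seq [RHS]big_seq; apply: eq_bigr => a sa.
  rewrite rmorphB /= map_polyX map_polyC /=.
  by rewrite -{1}(hr a sa).
have sz : size (map (@complex.Re R) s) == n.
  by rewrite -eqSS -(size_char_poly A) hp size_prod_XsubC.
by exists (Tuple sz); apply/eqP.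
Qed.

(* The eigenvalues with multiplicity, i.e. the roots of the characteristic
   polynomial, which splits over R because A is symmetric. They come in an
   unspecified order. *)
Definition eigenvalues (hA : A^T = A) : n.-tuple R :=
  xchoose (sym_char_poly_split hA).

Lemma eigenvaluesP (hA : A^T = A) :
  char_poly A = \prod_(x <- eigenvalues hA) ('X - x%:P).
Proof. exact/eqP/(xchooseP (sym_char_poly_split hA)). Qed.

End Spectrum.

Definition laplacian_eigenvalues (R : rcfType) (n : nat) (G : sgraph n) :
  n.-tuple R := eigenvalues (laplacian_sym R G).

Definition laplacian_moment (R : rcfType) (n : nat) (G : sgraph n) (k : nat) : R :=
  n%:R^-1 * \sum_(i < n) tnth (laplacian_eigenvalues R G) i ^+ k.

Section Distance.
Variables (n : nat) (G : sgraph n).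

Definition has_walk (i j : 'I_n) (l : nat) : bool :=
  [exists p : l.-tuple 'I_n, path G i p && (last i p == j)].

Lemma connect_has_walk (i j : 'I_n) : connect G i j -> exists l, has_walk i j l.
Proof.
case/connectP => p pp ->; exists (size p); apply/existsP.
by exists (in_tuple p); rewrite /= pp eqxx.
Qed.

(* None stands for an infinite distance: no walk joins i and j. *)
Definition distance (i j : 'I_n) : option nat :=
  match @idP (connect G i j) with
  | ReflectT h => Some (ex_minn (connect_has_walk h))
  | ReflectF _ => None
  end.

Definition neighborhood (i : 'I_n) (r : nat) : {set 'I_n} :=
  [set j | if distance i j is Some d then (d <= r)%N else false].

End Distance.

(* The submatrix on the rows and columns listed, in that order, by s. *)
Definition principal_submx (T : Type) (n m : nat) (A : 'M[T]_n)
    (s : m.-tuple 'I_n) : 'M[T]_m :=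
  mxsub (tnth s) (tnth s) A.

(* K, which is meant to contain i, listed with i first. *)
Definition nodes_from (n : nat) (K : {set 'I_n}) (i : 'I_n) :
    #|K :\ i|.+1.-tuple 'I_n :=
  [tuple of i :: enum_tuple (K :\ i)].

Definition local_laplacian (R : nzRingType) (n : nat) (G : sgraph n)
    (i : 'I_n) (r : nat) : 'M[R]_(#|neighborhood G i r :\ i|.+1) :=
  principal_submx (laplacian R G) (nodes_from (neighborhood G i r) i).

(* Main.v *)
Require Import Defs.
From mathcomp Require Import all_boot all_order all_algebra.
From mathcomp Require Import spectral complex.
Import Order.TTheory GRing.Theory Num.Theory.
Local Open Scope ring_scope.

Set Implicit Arguments.
Unset Strict Implicit.
Unset Printing Implicit Defensive.

(* The moment is a normalised trace: m_k(L) = tr(L^k) / n, as the symmetric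
   matrix L is diagonalisable over R[i]. Off-diagonal entries of L vanish
   outside the edges, so (L^b)_ij = 0 when j is at distance more than b from
   i. Writing (L^k)_ii as a sum of closed walks of length k <= 2r + 1 from i,
   no walk leaves the ball of radius r, hence the restriction to the ball
   computes the same diagonal entry. *)

(** Constant matrices commute with the scalar matrix of 'X, so the conjugation lifts to the
    characteristic matrix and the determinants of [P] and its inverse cancel. *)
Lemma char_poly_conj (F : fieldType) (n : nat) (P A : 'M[F]_n) :
  P \in unitmx -> char_poly (invmx P *m A *m P) = char_poly A.
Proof.
move=> Pu; pose f := map_mx (@polyC F) : 'M_n -> 'M_n.
have VP : f (invmx P) *m f P = 1%:M by rewrite /f -map_mxM mulVmx // map_mx1.
have E : char_poly_mx (invmx P *m A *m P) =
    f (invmx P) *m char_poly_mx A *m f P.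
  rewrite /char_poly_mx mulmxBr mulmxBl mul_mx_scalar -scalemxAl VP.
  by rewrite scalemx1 !map_mxM.
by rewrite /char_poly E !det_mulmx mulrAC -det_mulmx VP det1 mul1r.
Qed.

Lemma exp_mx_conj (F : fieldType) (n : nat) (P A : 'M[F]_n) (k : nat) :
  P \in unitmx -> (invmx P *m A *m P) ^+ k = invmx P *m A ^+ k *m P.
Proof.
move=> Pu; elim: k => [|k IHk]; first by rewrite !expr0 mulmx1 mulVmx.
by rewrite !exprS IHk -!mulmxE !mulmxA mulmxK.
Qed.

Lemma exp_diag_mx (R : nzRingType) (n : nat) (d : 'rV[R]_n) (k : nat) :
  diag_mx d ^+ k = diag_mx (\row_j d ord0 j ^+ k).
Proof.
elim: k => [|k IHk].
  rewrite expr0; apply/matrixP => i j; rewrite !mxE.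
  by case: eqP.
rewrite exprS IHk -mulmxE mulmx_diag; congr diag_mx.
by apply/rowP => j; rewrite !mxE exprS.
Qed.

Lemma mxtrace_exp_eigenvalues (R : rcfType) (n : nat) (A : 'M[R]_n)
    (hA : A^T = A) (k : nat) :
  \tr (A ^+ k) = \sum_(i < n) tnth (eigenvalues hA) i ^+ k.
Proof.
pose f := real_complex R; pose B : 'M[R[i]]_n := map_mx f A.
(* A symmetric matrix with real entries is normal, so the spectral theorem applies over [R[i]]. *)
have Bn : B \is normalmx.
  apply: symmetric_normalmx.
    by apply/is_hermitianmxP; rewrite scale1r map_mx_id // /B map_trmx hA.
  by apply/mxOverP => i j; rewrite mxE; apply/complex_realP; exists (A i j).
have := orthomx_spectralP Bn.
set P := spectralmx B; set d := spectral_diag B => BE.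
have Pu : P \in unitmx by exact: spectral_unit.
(* Both lists are the roots of the characteristic polynomial of [B]. Their orders are unrelated, but
   a power sum does not depend on the order. *)
have perm_ev : perm_eq [seq d ord0 i | i <- index_enum 'I_n]
                       [seq f x | x <- eigenvalues hA].
  apply: prod_XsubC_eq; rewrite !big_map /=.
  rewrite -map_prod_XsubC -eigenvaluesP map_char_poly -/B.
  rewrite BE char_poly_conj // char_poly_trig ?diag_mx_is_trig //.
  by apply: eq_bigr => i _; rewrite mxE eqxx.
apply: (fmorph_inj f); rewrite -trace_map_mx rmorphXn /= -/B.
rewrite BE exp_mx_conj // mxtrace_mulC mulmxA mulmxV // mul1mx exp_diag_mx.
rewrite mxtrace_diag rmorph_sum /=.
under eq_bigr do rewrite mxE.
have -> : \sum_i d ord0 i ^+ k =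
    \sum_(x <- [seq d ord0 i | i <- index_enum 'I_n]) x ^+ k.
  by rewrite big_map.
rewrite (perm_big _ perm_ev) /= big_map big_tuple.
by apply: eq_bigr => i _; rewrite rmorphXn.
Qed.

Section PrincipalSubmatrixPowers.
Variables (R : nzRingType) (n m : nat) (A : 'M[R]_n) (s : m.-tuple 'I_n).
Hypothesis s_uniq : uniq s.

Lemma sum_tuple_supported (F : 'I_n -> R) :
  (forall j, j \notin s -> F j = 0) -> \sum_j F j = \sum_(y < m) F (tnth s y).
Proof.
move=> F0; rewrite -(big_tuple _ _ s xpredT F) (bigID (mem s)) /=.
by rewrite [X in _ + X]big1 // addr0 big_uniq.
Qed.

(** Peel off the last factor: a walk that is outside [s] before its last step contributes 0. The
    endpoint lies in [s] anyway, which is why length [r.+1] is still allowed. *)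
Lemma exp_principal_submx_row (x : 'I_m) (r a : nat) :
  (forall b j, (b <= r)%N -> j \notin s -> (A ^+ b) (tnth s x) j = 0) ->
  (a <= r.+1)%N ->
  forall y, (principal_submx A s ^+ a) x y = (A ^+ a) (tnth s x) (tnth s y).
Proof.
move=> A0; elim: a => [|a IHa] ar y.
  by rewrite !expr0 !mxE (inj_eq (tuple_uniqP _ s_uniq)).
rewrite !exprSr -!mulmxE !mxE [RHS]sum_tuple_supported => [|j js].
  by apply: eq_bigr => z _; rewrite IHa 1?ltnW // mxE.
by rewrite A0 ?mul0r.
Qed.

(** The mirror image, peeling off the first factor. It is proved directly, as transposition does not
    reverse products over a noncommutative ring. *)
Lemma exp_principal_submx_col (x : 'I_m) (r a : nat) :
  (forall b j, (b <= r)%N -> j \notin s -> (A ^+ b) j (tnth s x) = 0) ->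
  (a <= r.+1)%N ->
  forall y, (principal_submx A s ^+ a) y x = (A ^+ a) (tnth s y) (tnth s x).
Proof.
move=> A0; elim: a => [|a IHa] ar y.
  by rewrite !expr0 !mxE (inj_eq (tuple_uniqP _ s_uniq)).
rewrite !exprS -!mulmxE !mxE [RHS]sum_tuple_supported => [|j js].
  by apply: eq_bigr => z _; rewrite IHa 1?ltnW // mxE.
by rewrite A0 ?mulr0.
Qed.

(* Splitting a closed walk of length at most 2r + 1 at its r-th step leaves
   two halves of lengths at most r and r + 1. *)
Lemma exp_principal_submx_diag (x : 'I_m) (r k : nat) :
  (forall b j, (b <= r)%N -> j \notin s -> (A ^+ b) (tnth s x) j = 0) ->
  (forall b j, (b <= r)%N -> j \notin s -> (A ^+ b) j (tnth s x) = 0) ->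
  (k <= 2 * r + 1)%N ->
  (principal_submx A s ^+ k) x x = (A ^+ k) (tnth s x) (tnth s x).
Proof.
move=> Ar Ac kr.
have [kr'|/ltnW rk] := leqP k r.
  by rewrite (exp_principal_submx_row Ar) // leqW.
rewrite -(subnKC rk) !exprD -!mulmxE !mxE [RHS]sum_tuple_supported => [|j js].
  apply: eq_bigr => y _.
  rewrite (exp_principal_submx_row Ar) // (exp_principal_submx_col Ac) //.
  (* The second half has length [k - r <= r.+1], which is exactly the bound on [k]. *)
  by rewrite leq_subLR addnS addnn -mul2n -addn1.
by rewrite Ar ?mul0r.
Qed.

End PrincipalSubmatrixPowers.

Lemma trmx_exp (R : comNzRingType) (n : nat) (A : 'M[R]_n) (k : nat) :
  (A ^+ k)^T = A^T ^+ k.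
Proof.
elim: k => [|k IHk]; first by rewrite !expr0 trmx1.
by rewrite exprS exprSr -!mulmxE trmx_mul IHk.
Qed.

Section LocalLaplacian.
Variables (n : nat) (G : sgraph n).

Lemma neighborhoodP (i j : 'I_n) (r : nat) :
  reflect (exists2 l, (l <= r)%N & has_walk G i j l) (j \in neighborhood G i r).
Proof.
(* [distance] matches on the proof [idP], whose content feeds [ex_minn], so the case split is on
   that term rather than on the boolean. *)
rewrite inE /distance; case: {-}_ / idP => [c|nc].
  case: ex_minnP => d wd dmin; apply: (iffP idP) => [dr|[l lr wl]].
    by exists d.
  exact: leq_trans (dmin l wl) lr.
constructor=> -[l _ /existsP [p /andP [pp /eqP pj]]]; apply: nc.
by apply/connectP; exists p.
Qed.

Lemma neighborhood_center (i : 'I_n) (r : nat) : i \in neighborhood G i r.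
Proof.
apply/neighborhoodP; exists 0%N => //; apply/existsP.
by exists [tuple]; rewrite /= eqxx.
Qed.

Lemma neighborhood_mono (i : 'I_n) :
  {homo neighborhood G i : r1 r2 / (r1 <= r2)%N >-> r1 \subset r2}.
Proof.
move=> r1 r2 r12; apply/subsetP => j /neighborhoodP [l lr wl].
by apply/neighborhoodP; exists l => //; exact: leq_trans lr r12.
Qed.

Lemma neighborhood_adj (i j h : 'I_n) (r : nat) :
  j \in neighborhood G i r -> G j h -> h \in neighborhood G i r.+1.
Proof.
move=> /neighborhoodP [l lr /existsP [p /andP [pp /eqP pj]]] jh.
apply/neighborhoodP; exists l.+1 => //; apply/existsP.
by exists [tuple of rcons p h]; rewrite /= rcons_path last_rcons pp pj jh eqxx.
Qed.

(** Each factor either stays at a node (a degree) or follows an edge, so the distance from [i] grows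
    by at most one per factor. *)
Lemma exp_laplacian_eq0 (R : nzRingType) (i j : 'I_n) (b : nat) :
  j \notin neighborhood G i b -> (laplacian R G ^+ b) i j = 0.
Proof.
elim: b j => [|b IHb] j jN.
  rewrite expr0 mxE; case: eqP => // ij.
  by rewrite -ij neighborhood_center in jN.
rewrite exprSr -mulmxE mxE big1 // => h _.
have [hN|hN] := boolP (h \in neighborhood G i b); last by rewrite IHb ?mul0r.
rewrite !mxE; case: eqVneq => [hj|_].
  by rewrite -hj (subsetP (neighborhood_mono i (leqnSn b))) in jN.
case hG: (G h j); last by rewrite subr0 mulr0.
by rewrite (neighborhood_adj hN hG) in jN.
Qed.

Lemma exp_local_laplacian_diag (R : comNzRingType) (i : 'I_n) (r k : nat) :
  (k <= 2 * r + 1)%N ->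
  (local_laplacian R G i r ^+ k) ord0 ord0 = (laplacian R G ^+ k) i i.
Proof.
move=> kr; set s := nodes_from (neighborhood G i r) i.
have si : tnth s ord0 = i by rewrite (tnth_nth i).
have s_uniq : uniq s by rewrite /= mem_enum !inE eqxx enum_uniq.
have row0 b j : (b <= r)%N -> j \notin s ->
    (laplacian R G ^+ b) (tnth s ord0) j = 0.
  rewrite si => br js; apply/exp_laplacian_eq0/(contra _ js) => jN.
  rewrite inE mem_enum !inE; case: eqVneq => //= _.
  by have := subsetP (neighborhood_mono i br) j jN; rewrite inE.
(* Columns reduce to rows because the powers of the Laplacian are symmetric. *)
have col0 b j : (b <= r)%N -> j \notin s ->
    (laplacian R G ^+ b) j (tnth s ord0) = 0.
  move=> br js; rewrite -[laplacian R G]laplacian_sym -trmx_exp mxE.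
  exact: row0.
by rewrite -[in RHS]si; apply: (exp_principal_submx_diag s_uniq row0 col0 kr).
Qed.

End LocalLaplacian.

Theorem mainTheorem1 (R : rcfType) (n : nat) (G : sgraph n) (r k : nat)
    (k_gt0 : (0 < k)%N) (k_le : (k <= 2 * r + 1)%N) :
  laplacian_moment R G k =
  n%:R^-1 * \sum_(i < n) (local_laplacian R G i r ^+ k) ord0 ord0.
Proof.
rewrite /laplacian_moment -mxtrace_exp_eigenvalues; congr (_ * _).
by apply: eq_bigr => i _; rewrite exp_local_laplacian_diag.
Qed.
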